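(* For every $n\ge 0$, the map $\phi'$ is a bijection from the set of Motzkin paths of length $2n$ to the set of paths in $\mathcal{A}^{Q}_{R}$ of horizontal length $n$, and also from the set of Grand Motzkin paths of length $2n$ to the set of paths in $\mathcal{A}^{H}_{R}$ of horizontal length $n$; its inverse is $\psi'$.
   Context: A lattice path is a finite sequence of steps (vectors in $\mathbb{Z}^2$) starting at $(0,0)$; its vertices are the partial sums. Let $S_{M}=\{(1,0),(1,1),(1,-1)\}$ and $S_{MW}=S_M\cup\{(0,1),(0,-1)\}$; $(0,\pm1)$ are vertical steps. A Grand Motzkin path of length $L$ is a lattice path of $L$ steps from $S_M$ (any endpoint); a Motzkin path of length $L$ is a Grand Motzkin path of length $L$ all of whose vertices have $y\ge0$. A vertically constrained $S_{MW}$ path is a lattice path with steps in $S_{MW}$ with no two consecutive vertical steps; its horizontal length is the $x$-coordinate of its endpoint. $\mathcal{A}^{H}_{R}$ is the set of vertically constrained $S_{MW}$ paths whose first step (if any) lies in $S_M$, and $\mathcal{A}^{Q}_{R}$ the subset of those all of whose vertices have $y\ge0$. The map $\phi'$ acts on a path with steps $e_1,\dots,e_{2n}$ by modifying each step $e_i$ with $i$ even: $(1,1)\mapsto(0,1)$, $(1,-1)\mapsto(0,-1)$, $(1,0)$ deleted; odd-indexed steps are kept. The map $\psi'$ acts on a path in $\mathcal{A}^H_R$ of horizontal length $n$: for each $i\in\{1,\dots,n\}$, if there is a vertical step at $x$-coordinate $i$ (there is at most one), replace $(0,1)$ by $(1,1)$ and $(0,-1)$ by $(1,-1)$; otherwise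 insert a step $(1,0)$ at the vertex with $x$-coordinate $i$ (subsequent steps shifted accordingly). *)

(* Defs.v *)
From HB Require Import structures.
From mathcomp Require Export all_boot all_order all_algebra.
Set Implicit Arguments.
Unset Strict Implicit.
Unset Printing Implicit Defensive.
Import GRing.Theory.
Local Open Scope ring_scope.

Definition step : Type := (int * int)%type.
Definition lpath : Type := seq step.

Definition flat : step := (1, 0).
Definition up : step := (1, 1).
Definition down : step := (1, -1).
Definition vup : step := (0, 1).
Definition vdown : step := (0, -1).

Definition S_M : seq step := [:: flat; up; down].
Definition vertical : seq step := [:: vup; vdown].
Definition S_MW : seq step := S_M ++ vertical.

(* The steps e_1, ..., e_L of p are the entries 0, ..., L - 1 of the sequence;
   the vertices are vertex p 0, ..., vertex p (size p), and entry k of p goes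
   from vertex p k to vertex p k.+1. *)
Definition stepn (p : lpath) (k : nat) : step := nth 0 p k.
Definition vertex (p : lpath) (k : nat) : step := \sum_(e <- take k p) e.
Definition endpoint (p : lpath) : step := \sum_(e <- p) e.
Definition hlength (p : lpath) : int := (endpoint p).1.

Definition nonneg (p : lpath) : bool :=
  all (fun k => 0 <= (vertex p k).2) (iota 0 (size p).+1).

Definition GrandMotzkin (L : nat) : pred lpath :=
  fun p => (size p == L) && all (mem S_M) p.

Definition Motzkin (L : nat) : pred lpath :=
  fun p => GrandMotzkin L p && nonneg p.

Definition vconstrained (p : lpath) : bool :=
  all (mem S_MW) p
  && sorted (fun e f => ~~ ((e \in vertical) && (f \in vertical))) p.

Definition AHR : pred lpath :=
  fun p => vconstrained p && (if p is e :: _ then e \in S_M else true).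

Definition AQR : pred lpath := fun p => AHR p && nonneg p.

Definition AHR_of_hlength (n : nat) : pred lpath :=
  fun p => AHR p && (hlength p == n%:Z).

Definition AQR_of_hlength (n : nat) : pred lpath :=
  fun p => AQR p && (hlength p == n%:Z).

(* i is the 1-based index of the step e. *)
Definition phi_step (i : nat) (e : step) : lpath :=
  if odd i then [:: e]
  else if e == up then [:: vup]
  else if e == down then [:: vdown]
  else if e == flat then [::]
  else [:: e].

Definition phi (p : lpath) : lpath :=
  flatten [seq phi_step i (stepn p i.-1) | i <- iota 1 (size p)].

Definition in_range (p : lpath) (k : nat) : bool :=
  1 <= (vertex p k).1 <= hlength p.

Definition has_vertical_at (p : lpath) (x : int) : bool :=
  has (fun k => (stepn p k \in vertical) && ((vertex p k).1 == x))
      (iota 0 (size p)).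

(* The (1,0) step, if any, to be inserted at the k-th vertex.  If no vertical
   step has x-coordinate x, at most one vertex of a path with steps in S_MW
   has x-coordinate x, so at most one step is inserted for each x. *)
Definition psi_insert (p : lpath) (k : nat) : lpath :=
  if in_range p k && ~~ has_vertical_at p (vertex p k).1
  then [:: flat] else [::].

Definition psi_replace (p : lpath) (k : nat) : step :=
  let e := stepn p k in
  if in_range p k then
    if e == vup then up else if e == vdown then down else e
  else e.

(* All x-coordinates refer to the original path p; concatenation performs the
   shift of the subsequent steps. *)
Definition psi (p : lpath) : lpath :=
  flatten [seq rcons (psi_insert p k) (psi_replace p k) | k <- iota 0 (size p)]
  ++ psi_insert p (size p).

Definition bijection_between (A B : pred lpath) (f : lpath -> lpath) : Prop :=
  [/\ forall p, p \in A -> f p \in B,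
      {in A &, injective f}
    & forall q, q \in B -> exists2 p, p \in A & f p = q].

Definition inverse_between (A B : pred lpath) (f g : lpath -> lpath) : Prop :=
  [/\ forall q, q \in B -> g q \in A,
      {in A, cancel f g}
    & {in B, cancel g f}].

(* Main.v *)
Require Import Defs.
Set Implicit Arguments.
Unset Strict Implicit.
Unset Printing Implicit Defensive.
Import Order.TTheory GRing.Theory Num.Theory.
Local Open Scope ring_scope.

(** Cut a Grand Motzkin path of length [2n] into [n] consecutive pairs [(e, f)]
    of steps of [S_M].  The map [phi] turns such a pair into the block made of
    [e] followed by at most one vertical step, and the paths of horizontal
    length [n] in [AHR] are exactly the concatenations of [n] such blocks.  The
    [i]-th block contains the only vertical step that can occur at
    [x]-coordinate [i], so [psi] recovers [f] from each block.  Both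
    concatenations visit the same heights, which settles the nonnegative case. *)

(** * Pairs of steps and their blocks *)

Definition path_of_pairs (l : seq (step * step)) : lpath :=
  flatten [seq [:: b.1; b.2] | b <- l].

(** The index 2 stands for any even index, since [phi_step] depends only on parity. *)
Definition vpath_of_pairs (l : seq (step * step)) : lpath :=
  flatten [seq b.1 :: phi_step 2 b.2 | b <- l].

Definition Motzkin_pairs (l : seq (step * step)) : bool :=
  all (fun b => (b.1 \in S_M) && (b.2 \in S_M)) l.

(** Phrased as an elimination rule: applying it leaves three goals about concrete steps, which
    compute. *)
Lemma S_MP (P : step -> Prop) :
  P flat -> P up -> P down -> forall e, e \in S_M -> P e.
Proof.
by move=> Pf Pu Pd e; rewrite !inE => /or3P[] /eqP->.
Qed.

Lemma path_of_pairs_cons e f l :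
  path_of_pairs ((e, f) :: l) = [:: e, f & path_of_pairs l].
Proof. by []. Qed.

Lemma vpath_of_pairs_cons e f l :
  vpath_of_pairs ((e, f) :: l) = (e :: phi_step 2 f) ++ vpath_of_pairs l.
Proof. by []. Qed.

Lemma vpath_of_pairs_cat l1 l2 :
  vpath_of_pairs (l1 ++ l2) = vpath_of_pairs l1 ++ vpath_of_pairs l2.
Proof. by rewrite /vpath_of_pairs map_cat flatten_cat. Qed.

Lemma GrandMotzkin_pairsP n p :
  reflect (exists l, [/\ Motzkin_pairs l, size l = n & p = path_of_pairs l])
          (p \in GrandMotzkin (2 * n)).
Proof.
apply: (iffP idP) => [|[l [Ml <- ->]]]; last first.
  rewrite /GrandMotzkin unfold_in; elim: l Ml => //= b l IH /andP[/andP[b1 b2]].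
  move=> /IH /andP[/eqP sz al]; rewrite /= b1 b2 al sz andbT.
  by rewrite mulnS eqxx.
rewrite /GrandMotzkin unfold_in mul2n.
elim: n p => [|n IH] [|a [|b p]] //=.
  by move=> _; exists [::].
rewrite !eqSS => /andP[sz /and3P[Sa Sb Sp]].
have [|l [Ml <- ->]] := IH p; first by rewrite sz.
by exists ((a, b) :: l); rewrite /= Sa Sb.
Qed.

(** * Horizontal length and block decomposition *)

Lemma endpoint_cat s t : endpoint (s ++ t) = endpoint s + endpoint t.
Proof. exact: big_cat. Qed.

Lemma hlength_cat s t : hlength (s ++ t) = hlength s + hlength t.
Proof. by rewrite /hlength endpoint_cat. Qed.

Lemma hlength_cons e t : hlength (e :: t) = e.1 + hlength t.
Proof. by rewrite /hlength /endpoint big_cons. Qed.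

Lemma hlength_phi_step2 f : f \in S_M -> hlength (phi_step 2 f) = 0.
Proof.
by move: f; apply: S_MP; rewrite /phi_step /= ?hlength_cons /hlength /endpoint
  big_nil.
Qed.

Lemma hlength_block e f :
  e \in S_M -> f \in S_M -> hlength (e :: phi_step 2 f) = 1.
Proof.
by move=> + Sf; move: e; apply: S_MP; rewrite hlength_cons hlength_phi_step2.
Qed.

Lemma hlength_vpath_of_pairs l :
  Motzkin_pairs l -> hlength (vpath_of_pairs l) = (size l)%:Z.
Proof.
elim: l => [_|[e f] l IH /= /andP[/andP[Se Sf] Ml]].
  by rewrite /hlength /endpoint big_nil.
by rewrite vpath_of_pairs_cons hlength_cat hlength_block // IH // -add1n PoszD.
Qed.

(** Every block opens with a step of [S_M], so a vertical step, which ends its block, is never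
    followed by another one. *)
Lemma vpath_of_pairs_AHR l : Motzkin_pairs l -> AHR (vpath_of_pairs l).
Proof.
move=> Ml; rewrite /AHR /vconstrained; apply/andP; split; last first.
  by case: l Ml => //= b l /andP[/andP[]].
set r := (X in sorted X).
have SMr x e : e \in S_M -> r x e.
  by move: e; apply: S_MP; rewrite /r andbF.
have SMl e x : e \in S_M -> r e x by move: e; apply: S_MP.
apply/andP; split.
  elim: l Ml => //= -[e f] l IH /= /andP[/andP[Se Sf] /IH Al].
  rewrite all_cat Al andbT /=; apply/andP; split.
    by rewrite /S_MW mem_cat Se.
  by move: f Sf; apply: S_MP.
(* Any predecessor [x] is allowed because the first step lies in [S_M]; the value 0 is arbitrary. *)
suff H x : path r x (vpath_of_pairs l) by have /path_sorted := H 0.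
elim: l x Ml => //= -[e f] l IH x /= /andP[/andP[Se Sf] Ml].
rewrite SMr // cat_path IH // andbT.
by move: f Sf; apply: S_MP; rewrite //= SMl.
Qed.

(* A path starting with a vertical step lacks the first half of its first
   block; allowing for this makes the decomposition provable step by step. *)
Lemma vconstrained_split q : vconstrained q ->
  exists f l, [/\ f \in S_M, Motzkin_pairs l
                & q = phi_step 2 f ++ vpath_of_pairs l].
Proof.
rewrite /vconstrained; elim: q => [_|e q IH].
  by exists flat, [::].
move=> /= /andP[/andP[Se Sq] srt].
have [f [l [Sf Ml Eq]]] := IH (introT andP (conj Sq (path_sorted srt))).
have [eM|] := boolP (e \in S_M).
  by exists flat, ((e, f) :: l); rewrite /= eM Sf Ml Eq.
move: Se; rewrite mem_cat => /orP[->//|Ve] _.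
(* Otherwise the tail would begin with a vertical step right after the vertical step [e]. *)
have Ef : f = flat.
  move: srt; rewrite Eq; move: f Sf {Eq}.
  by apply: S_MP => //=; rewrite Ve.
move: Ve; rewrite !inE => /orP[] /eqP->.
  by exists up, l; rewrite Eq Ef.
by exists down, l; rewrite Eq Ef.
Qed.

(** A first step in [S_M] rules out the incomplete leading block of [vconstrained_split], and each
    block has horizontal length 1. *)
Lemma AHR_pairsP n q :
  reflect (exists l, [/\ Motzkin_pairs l, size l = n & q = vpath_of_pairs l])
          (q \in AHR_of_hlength n).
Proof.
rewrite /AHR_of_hlength unfold_in.
apply: (iffP andP) => [[/andP[/vconstrained_split[f [l [Sf Ml ->]]] hd] hl]|].
  exists l; have Ef : f = flat by move: f Sf hd {hl}; apply: S_MP.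
  by move: hl; rewrite Ef hlength_vpath_of_pairs //= => /eqP[].
by case=> l [Ml <- ->]; rewrite vpath_of_pairs_AHR // hlength_vpath_of_pairs.
Qed.

(** * The map [phi] on pairs, and heights *)

Lemma phi_cons2 a b p : phi [:: a, b & p] = a :: phi_step 2 b ++ phi p.
Proof.
rewrite /phi /= -[3%N]/(2 + 1)%N iotaDl -map_comp; congr (_ :: _ ++ flatten _).
(* Index 0, where the truncated predecessor would break the shift by 2, lies outside the range. *)
apply/eq_in_map => -[|i] //; rewrite mem_iota => // _.
by rewrite /= /phi_step /= negbK.
Qed.

Lemma phi_path_of_pairs l : phi (path_of_pairs l) = vpath_of_pairs l.
Proof. by elim: l => // -[e f] l IH; rewrite path_of_pairs_cons phi_cons2 IH. Qed.

(** The starting height [y] is a parameter so that induction can strip steps off the front. *)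
Definition nonneg_from (y : int) (p : lpath) : bool :=
  all (fun k => 0 <= y + (vertex p k).2) (iota 0 (size p).+1).

Lemma nonneg_from0 p : nonneg_from 0 p = nonneg p.
Proof. by apply: eq_all => k; rewrite add0r. Qed.

Lemma nonneg_from_nil y : nonneg_from y [::] = (0 <= y).
Proof. by rewrite /nonneg_from /= /vertex big_nil addr0 andbT. Qed.

Lemma nonneg_from_cons y e p :
  nonneg_from y (e :: p) = (0 <= y) && nonneg_from (y + e.2) p.
Proof.
rewrite /nonneg_from.
have -> : iota 0 (size (e :: p)).+1 = 0%N :: map (addn 1) (iota 0 (size p).+1).
  by rewrite -iotaDl.
rewrite -[_ :: map _ _]cat1s all_cat all_seq1 {1}/vertex take0 big_nil addr0 all_map.
congr (_ && _); apply: eq_all => k /=.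
by rewrite /vertex /= big_cons addrA.
Qed.

Lemma nonneg_from_ge0 y p : nonneg_from y p -> 0 <= y.
Proof. by case: p => [|e p]; rewrite ?nonneg_from_nil // nonneg_from_cons => /andP[]. Qed.

(** A vertical step changes the height as the diagonal step it replaces, and a deleted flat step
    only repeats a height. *)
Lemma nonneg_from_pairs y l : Motzkin_pairs l ->
  nonneg_from y (path_of_pairs l) = nonneg_from y (vpath_of_pairs l).
Proof.
elim: l y => //= -[e f] l IH y /= /andP[/andP[_ Sf] Ml].
rewrite path_of_pairs_cons vpath_of_pairs_cons !nonneg_from_cons; congr (_ && _).
move: f Sf; apply: S_MP; rewrite /phi_step /= ?nonneg_from_cons IH //.
(* For [f] flat, the extra test on the left concerns the height where the rest of the path starts,
   so it is implied. *)
rewrite addr0; case: (boolP (nonneg_from _ _)) => [/nonneg_from_ge0->//|].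
by rewrite andbF.
Qed.

Lemma nonneg_pairs l : Motzkin_pairs l ->
  nonneg (path_of_pairs l) = nonneg (vpath_of_pairs l).
Proof. by move=> Ml; rewrite -!nonneg_from0 nonneg_from_pairs. Qed.

(** * Location of the vertical steps *)

Lemma vertex0 p : vertex p 0 = 0.
Proof. by rewrite /vertex take0 big_nil. Qed.

Lemma vertex_cat_shift s t k :
  vertex (s ++ t) (size s + k) = endpoint s + vertex t k.
Proof. by rewrite /vertex take_cat ltnNge leq_addr /= addKn big_cat. Qed.

Lemma vertex_cat_lt s t k : (k < size s)%N -> vertex (s ++ t) k = vertex s k.
Proof. by move=> lt_ks; rewrite /vertex take_cat lt_ks. Qed.

Lemma stepn_cat_shift s t k : stepn (s ++ t) (size s + k) = stepn t k.
Proof. by rewrite /stepn nth_cat ltnNge leq_addr /= addKn. Qed.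

Lemma has_vertical_at_cat s t x :
  has_vertical_at (s ++ t) x =
  has_vertical_at s x || has_vertical_at t (x - hlength s).
Proof.
rewrite /has_vertical_at size_cat iotaD has_cat add0n; congr (_ || _).
  apply: eq_in_has => k; rewrite mem_iota => /= lt_ks.
  by rewrite vertex_cat_lt // /stepn nth_cat lt_ks.
rewrite -[X in iota X _]addn0 iotaDl has_map; apply: eq_has => k /=.
rewrite stepn_cat_shift vertex_cat_shift; congr (_ && _).
by rewrite [RHS]eq_sym subr_eq [in RHS]addrC [LHS]eq_sym.
Qed.

Lemma has_vertical_at_block e f x : e \in S_M -> f \in S_M ->
  has_vertical_at (e :: phi_step 2 f) x = (f != flat) && (x == 1).
Proof.
move=> + Sf; move: e; apply: S_MP; move: f Sf; apply: S_MP;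
  rewrite /has_vertical_at /phi_step /= /vertex /= ?big_cons ?big_nil //=;
  by rewrite orbF eq_sym.
Qed.

Lemma has_vertical_at_range l x : Motzkin_pairs l ->
  has_vertical_at (vpath_of_pairs l) x -> 1 <= x <= (size l)%:Z.
Proof.
elim: l x => //= -[e f] l IH x /= /andP[/andP[Se Sf] Ml].
rewrite vpath_of_pairs_cons has_vertical_at_cat hlength_block //.
rewrite has_vertical_at_block // -add1n PoszD => /orP[/andP[_ /eqP->]|].
  by rewrite lexx lerDl.
move=> /(IH _ Ml); rewrite lerBlDl => /andP[x1 ->]; rewrite andbT.
by apply: le_trans x1 _; rewrite gerDl.
Qed.

(** Vertical steps of earlier blocks have [x] at most [size l1], those of later blocks at least
    [size l1 + 2]; only the block of [(e, f)] remains. *)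
Lemma has_vertical_at_pairs l1 e f l2 :
  Motzkin_pairs (l1 ++ (e, f) :: l2) ->
  has_vertical_at (vpath_of_pairs (l1 ++ (e, f) :: l2)) ((size l1)%:Z + 1) =
  (f != flat).
Proof.
rewrite /Motzkin_pairs all_cat /= => /and3P[M1 /andP[Se Sf] M2].
rewrite vpath_of_pairs_cat has_vertical_at_cat hlength_vpath_of_pairs //.
rewrite addrAC subrr add0r vpath_of_pairs_cons has_vertical_at_cat hlength_block //.
rewrite subrr has_vertical_at_block // eqxx andbT.
case: (boolP (has_vertical_at _ _)) => [/(has_vertical_at_range M1)|_].
  by case/andP=> _; rewrite gerDl.
case: (boolP (has_vertical_at _ _)) => [/(has_vertical_at_range M2)|_].
  by case/andP.
by rewrite orbF.
Qed.

(** * The map [psi] on blocks *)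

(** Groups each step with the insertion at the vertex after it rather than before it, so that the
    groups respect the blocks. *)
Lemma psiE p :
  psi p = psi_insert p 0 ++
          flatten [seq psi_replace p k :: psi_insert p k.+1 | k <- iota 0 (size p)].
Proof.
rewrite /psi -{2}[size p]add0n; move: (size p) 0%N.
elim=> [|m IH] k /=; first by rewrite cats0 addn0.
by rewrite -catA addnS -addSn IH -cats1 -catA.
Qed.

Lemma in_range_pairs l1 b l2 k (p := vpath_of_pairs (l1 ++ b :: l2)) :
  Motzkin_pairs (l1 ++ b :: l2) -> (vertex p k).1 = (size l1)%:Z + 1 ->
  in_range p k.
Proof.
move=> Ml Ek; rewrite /in_range Ek hlength_vpath_of_pairs // size_cat /=.
by rewrite lerDr addnS -addSn PoszD -addn1 PoszD lerDl.
Qed.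

Lemma psi_insert_pairs l1 e f l2 k (p := vpath_of_pairs (l1 ++ (e, f) :: l2)) :
  Motzkin_pairs (l1 ++ (e, f) :: l2) -> (vertex p k).1 = (size l1)%:Z + 1 ->
  psi_insert p k = if f == flat then [:: flat] else [::].
Proof.
move=> Ml Ek; rewrite /psi_insert (in_range_pairs Ml Ek) Ek.
by rewrite has_vertical_at_pairs // negbK.
Qed.

Lemma psi_replace_S_M p k : stepn p k \in S_M -> psi_replace p k = stepn p k.
Proof.
rewrite /psi_replace; case: ifP => // _; move: (stepn p k).
exact: S_MP.
Qed.

(** Since [psi] refers to coordinates of the whole path, [p] must stay fixed: the induction moves
    blocks from [l2] to the end of [l1]. *)
Lemma psi_vpath_suffix l1 l2 (p := vpath_of_pairs (l1 ++ l2)) :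
  Motzkin_pairs (l1 ++ l2) ->
  flatten [seq psi_replace p k :: psi_insert p k.+1
          | k <- iota (size (vpath_of_pairs l1)) (size (vpath_of_pairs l2))] =
  path_of_pairs l2.
Proof.
rewrite {}/p; elim: l2 l1 => // -[e f] l2 IH l1 Ml.
set p := vpath_of_pairs (l1 ++ _).
have Ep : p = vpath_of_pairs l1 ++ (e :: phi_step 2 f) ++ vpath_of_pairs l2.
  by rewrite /p vpath_of_pairs_cat.
have [M1 Se Sf] : [/\ Motzkin_pairs l1, e \in S_M & f \in S_M].
  by move: Ml; rewrite /Motzkin_pairs all_cat /= => /and3P[? /andP[]].
rewrite vpath_of_pairs_cons size_cat iotaD map_cat flatten_cat.
have -> : (size (vpath_of_pairs l1) + size (e :: phi_step 2 f))%N =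
    size (vpath_of_pairs (rcons l1 (e, f))).
  by rewrite -cats1 vpath_of_pairs_cat size_cat vpath_of_pairs_cons cats0.
have := IH (rcons l1 (e, f)); rewrite cat_rcons => /(_ Ml) ->.
rewrite path_of_pairs_cons -[RHS]/([:: e; f] ++ _); congr (_ ++ _).
have x1 : (vertex p (size (vpath_of_pairs l1)).+1).1 = (size l1)%:Z + 1.
  rewrite Ep -[(size _).+1]addn1 vertex_cat_shift /= -/(hlength _) hlength_vpath_of_pairs //.
  by rewrite /vertex /= take0 big_seq1; congr (_ + _); move: e Se {Ml p Ep}; apply: S_MP.
have e0 : psi_replace p (size (vpath_of_pairs l1)) = e.
  have st : stepn p (size (vpath_of_pairs l1)) = e.
    by rewrite Ep -[size _]addn0 stepn_cat_shift.
  by rewrite psi_replace_S_M st.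
(* For [f] flat the block is [e] alone, and the insertion after it restores [f]. *)
have [Ef|nf] := eqVneq f flat.
  by rewrite Ef /= e0 (psi_insert_pairs Ml x1) Ef.
(* A vertical step keeps [x], so both its ends have the coordinate of a vertical step and nothing is
   inserted at either. *)
have x2 : (vertex p (size (vpath_of_pairs l1)).+2).1 = (size l1)%:Z + 1.
  rewrite Ep -[(size _).+2]addn2 vertex_cat_shift /= -/(hlength _) hlength_vpath_of_pairs //.
  congr (_ + _); move: e Se f Sf nf {Ml p Ep x1 e0}.
  by apply: S_MP; apply: S_MP; rewrite // /vertex /= take0 big_cons big_seq1.
have f1 : psi_replace p (size (vpath_of_pairs l1)).+1 = f.
  rewrite /psi_replace (in_range_pairs Ml x1) {1 2 3}Ep -[(size _).+1]addn1 !stepn_cat_shift.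
  by move: f Sf nf {Ml p Ep x1 x2 e0}; apply: S_MP.
have -> : size (e :: phi_step 2 f) = 2%N.
  by move: f Sf nf {Ml p Ep x1 x2 e0 f1}; apply: S_MP.
rewrite /= e0 f1 (psi_insert_pairs Ml x1) (psi_insert_pairs Ml x2).
by rewrite (negbTE nf).
Qed.

Lemma psi_vpath_of_pairs l : Motzkin_pairs l ->
  psi (vpath_of_pairs l) = path_of_pairs l.
Proof.
(* The initial vertex has [x] equal to 0, so it is out of range and receives no insertion. *)
move=> Ml; rewrite psiE {1}/psi_insert /in_range vertex0 /=.
exact: (@psi_vpath_suffix [::]).
Qed.

(** * Assembling the bijections *)

Lemma inverse_bijection (A B : pred lpath) (f g : lpath -> lpath) :
  (forall p, p \in A -> f p \in B) -> inverse_between A B f g ->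
  bijection_between A B f.
Proof.
move=> AB [BA fK gK]; split=> //; first exact: can_in_inj fK.
by move=> q Bq; exists (g q); [exact: BA | exact: gK].
Qed.

Theorem theorem8 (n : nat) :
  (bijection_between (Motzkin (2 * n)) (AQR_of_hlength n) phi
   /\ inverse_between (Motzkin (2 * n)) (AQR_of_hlength n) phi psi)
  /\ (bijection_between (GrandMotzkin (2 * n)) (AHR_of_hlength n) phi
   /\ inverse_between (GrandMotzkin (2 * n)) (AHR_of_hlength n) phi psi).
Proof.
(* Preservation of [nonneg] is carried along, so that the Motzkin case follows by restriction. *)
have phiP p : p \in GrandMotzkin (2 * n) ->
    [/\ phi p \in AHR_of_hlength n, psi (phi p) = p & nonneg (phi p) = nonneg p].
  case/GrandMotzkin_pairsP=> l [Ml sz ->]; rewrite phi_path_of_pairs.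
  rewrite psi_vpath_of_pairs // nonneg_pairs //; split=> //.
  by apply/AHR_pairsP; exists l.
have psiP q : q \in AHR_of_hlength n ->
    [/\ psi q \in GrandMotzkin (2 * n), phi (psi q) = q & nonneg (psi q) = nonneg q].
  case/AHR_pairsP=> l [Ml sz ->]; rewrite psi_vpath_of_pairs //.
  rewrite phi_path_of_pairs nonneg_pairs //; split=> //.
  by apply/GrandMotzkin_pairsP; exists l.
have inMotzkin p : (p \in Motzkin (2 * n)) =
  (p \in GrandMotzkin (2 * n)) && nonneg p by [].
have inAQR q : (q \in AQR_of_hlength n) = (q \in AHR_of_hlength n) && nonneg q.
  by rewrite /AQR_of_hlength /AQR /AHR_of_hlength !unfold_in andbAC.
have invM : inverse_between (Motzkin (2 * n)) (AQR_of_hlength n) phi psi.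
  split=> p; rewrite ?inMotzkin ?inAQR => /andP[].
  - by case/psiP=> -> _ ->.
  - by case/phiP.
  - by case/psiP.
have invG : inverse_between (GrandMotzkin (2 * n)) (AHR_of_hlength n) phi psi.
  by split=> p; [case/psiP | case/phiP | case/psiP].
split; split=> //.
  apply: inverse_bijection invM => p.
  by rewrite inMotzkin inAQR => /andP[/phiP[-> _ ->]].
by apply: inverse_bijection invG => p /phiP[].
Qed.
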